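(* Let $(B,\star,\cdot)$ be a (finite) skew brace and let $A$ be a strong left ideal of $(B,\star,\cdot)$. Then $(B,\cdot,B/A,\star,\odot)$ is a skew bracoid, where $(B/A,\star)$ denotes the quotient group of $(B,\star)$ by $(A,\star)$ and $\odot$ denotes left translation of cosets with respect to $\cdot$.
   Context: All groups, skew braces and skew bracoids are finite. A (left) skew brace is a triple $(B,\star,\cdot)$ such that $(B,\star)$ and $(B,\cdot)$ are groups and $a\cdot(b\star c)=(a\cdot b)\star a^{-1}\star(a\cdot c)$ for all $a,b,c\in B$, where $a^{-1}$ is the inverse of $a$ in $(B,\star)$. Its $\gamma$-function is $\gamma:B\to\mathrm{Perm}(B)$, ${}^{\gamma(b)}a=b^{-1}\star(b\cdot a)$, with $b^{-1}$ the inverse in $(B,\star)$ (in fact $\gamma$ takes values in $\mathrm{Aut}(B,\star)$ and is a homomorphism from $(B,\cdot)$). A left ideal of $(B,\star,\cdot)$ is a subset $A\subseteq B$ that is a subgroup of $(B,\star)$, a subgroup of $(B,\cdot)$, and satisfies ${}^{\gamma(B)}A=A$. A strong left ideal is a left ideal $A$ such that $(A,\star)$ is normal in $(B,\star)$. For a left ideal, the left cosets $b\star A$ and $b\cdot A$ coincide for each $b\in B$, so $B/A$ may be viewed as the set of left cosets $bA$ with respect to either operation; left translation is $b\odot(cA)=(b\cdot c)A$. A (left) skew bracoid is a $5$-tuple $(G,\cdot,N,\star,\odot)$ such that $(G,\cdot)$ and $(N,\star)$ are groups and $\odot$ is a transitive action of $(G,\cdot)$ on the set $N$ such that $g\odot(\eta\star\mu)=(g\odot\eta)\star(g\odot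 e_N)^{-1}\star(g\odot\mu)$ for all $g\in G$ and $\eta,\mu\in N$, where $e_N$ is the identity of $N$ and $(g\odot e_N)^{-1}$ is the inverse in $(N,\star)$. *)

(* Defs.v *)
From HB Require Import structures.
From mathcomp Require Import all_boot all_fingroup.

Set Implicit Arguments.
Unset Strict Implicit.
Unset Printing Implicit Defensive.

Local Open Scope group_scope.

(* Finite skew braces.  The [finGroupType] structure (notations [*], [^-1],   *)
(* [1]) is the group (B, star); the group (B, .) is carried by [dot].         *)
HB.mixin Record FinGroup_isSkewBrace B of FinGroup B := {
  dot : B -> B -> B;
  dot1 : B;
  dotV : B -> B;
  dotA : associative dot;
  dot1b : left_id dot1 dot;
  dotVb : left_inverse dot1 dotV dot;
  dot_brace : forall a b c : B, dot a (b * c) = dot a b * a^-1 * dot a c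
}.

#[short(type="skewBraceType")]
HB.structure Definition SkewBrace := { B of FinGroup B & FinGroup_isSkewBrace B }.

(* A copy of the carrier B, on which [*], [^-1], [1] mean the group (B, .).   *)
Definition dot_group (B : skewBraceType) : Type := B.

HB.instance Definition _ (B : skewBraceType) := Finite.on (dot_group B).
HB.instance Definition _ (B : skewBraceType) :=
  Finite_isGroup.Build (dot_group B) (@dotA B) (@dot1b B) (@dotVb B).

Definition gamma (B : skewBraceType) (b a : B) : B := b^-1 * dot b a.

(* That A is a subgroup of (B, star) is part of the type [{group B}].         *)
Definition left_ideal (B : skewBraceType) (A : {group B}) : Prop :=
  group_set (A : {set dot_group B}) /\
  [set gamma b a | b in [set: B], a in A] = A.

Definition strong_left_ideal (B : skewBraceType) (A : {group B}) : Prop :=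
  left_ideal A /\ A <| [set: B].

Record is_skew_bracoid (G N : finGroupType) (odot : G -> N -> N) : Prop := {
  odot_id : forall eta : N, odot 1 eta = eta;
  odot_mul : forall (g h : G) (eta : N), odot (g * h) eta = odot g (odot h eta);
  odot_trans : forall eta mu : N, exists g : G, odot g eta = mu;
  odot_star : forall (g : G) (eta mu : N),
    odot g (eta * mu) = odot g eta * (odot g 1)^-1 * odot g mu
}.

(* [coset A c] is the coset cA when A is normal in (B, star), in which case   *)
(* every element of [coset_of A] has this form and [coset_of A] is the full   *)
(* quotient group B / A.  Independence of the representative chosen here is   *)
(* [left_translationE] below.                                                 *)
Definition left_translation (B : skewBraceType) (A : {group B})
    (b : dot_group B) (X : coset_of A) : coset_of A :=
  coset A (dot (b : B) (repr X)).

Lemma dot_coset (B : skewBraceType) (A : {group B}) (b : B) :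
  left_ideal A -> [set dot b a | a in A] = b *: A.
Proof.
case=> _ gammaA.
have injb : injective (dot b).
  by move=> x y; apply: (@mulgI (dot_group B) b x y).
apply/eqP; rewrite eqEcard card_lcoset card_imset // leqnn andbT.
apply/subsetP=> _ /imsetP[a Aa ->].
have : gamma b a \in [set gamma x y | x in [set: B], y in A].
  by apply: imset2_f; rewrite ?inE.
by rewrite gammaA mem_lcoset.
Qed.

Lemma left_translationE (B : skewBraceType) (A : {group B}) (b c : B) :
  strong_left_ideal A -> left_translation b (coset A c) = coset A (dot b c).
Proof.
case=> lA nA.
have inN x : x \in 'N(A) by apply: (subsetP (normal_norm nA)); rewrite inE.
have : repr (coset A c) \in c *: A.
  by rewrite -norm_rlcoset // -(val_coset (inN c)) mem_repr_coset.
rewrite -(dot_coset _ lA) => /imsetP[a Aa repE].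
rewrite /left_translation repE (dotA b c a).
have : dot (dot b c) a \in dot b c *: A by rewrite -(dot_coset _ lA) imset_f.
rewrite -norm_rlcoset // => /rcosetP[x Ax ->].
by rewrite coset_kerl.
Qed.

(* Main.v *)
Require Import Defs.
From HB Require Import structures.
From mathcomp Require Import all_boot all_fingroup.

Local Open Scope group_scope.

(** By [left_translationE], translation may be computed on any representative, so each bracoid axiom
    is the image in the quotient of an identity of [B]. The compatibility axiom comes from
    [dot_brace] through the morphism [coset A], since [dotb_star1] makes [g] send the trivial coset
    to [coset A g]. *)

(** Taking both arguments trivial in [dot_brace] and cancelling [dot b 1] leaves
    [b^-1 * dot b 1 = 1]. *)
Lemma dotb_star1 (B : skewBraceType) (b : B) : dot b 1 = b.
Proof.
have := dot_brace b 1 1.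
rewrite mulg1 -mulgA -[LHS]mulg1 => /mulgI /esym /eqP.
by rewrite -eq_mulVg1 => /eqP.
Qed.

Lemma coset_repP (B : skewBraceType) (A : {group B}) (X : coset_of A) :
  exists x : B, X = coset A x.
Proof. by have [x _ ->] := cosetP X; exists x. Qed.

Theorem proposition2p4 (B : skewBraceType) (A : {group B})
    (strongA : strong_left_ideal A) :
  is_skew_bracoid (G := dot_group B) (N := coset_of A) (@left_translation B A).
Proof.
have transE := fun b c : B => left_translationE b c strongA.
have normalizes (x : B) : x \in 'N(A).
  by case: strongA => _ /normal_norm/subsetP; apply; rewrite inE.
split=> [X | g h X | X Y | g X Y].
- by have [x ->] := coset_repP _ _ X; rewrite transE dot1b.
- by have [x ->] := coset_repP _ _ X; rewrite !transE dotA.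
- have [x ->] := coset_repP _ _ X; have [y ->] := coset_repP _ _ Y.
  by exists (dot y (dotV x)); rewrite transE; congr coset; exact: (@mulgKV (dot_group B) x y).
- have [x ->] := coset_repP _ _ X; have [y ->] := coset_repP _ _ Y.
  (* The unit of the quotient is written as [coset A 1] so that [transE] also applies to the
     translate of the unit. *)
  rewrite -morphM // -(coset_id (group1 A)) !transE.
  by rewrite dot_brace dotb_star1 !morphM ?morphV.
Qed.
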